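(* Let $(Q,* )$ be a finite $2$-divisible semimedial left quasigroup, with squaring map $\mathfrak{s}$, and let $x\cdot_{\mathfrak{s}}y=\mathfrak{s}^{-1}(x*y)$. Then $(Q,* )$ is solvable if and only if $(Q,\cdot_{\mathfrak{s}})$ is solvable.
   Context: A left quasigroup is a (nonempty) set $Q$ with a binary operation $*$ such that every $L_x:y\mapsto x*y$ is a bijection (with $x\backslash y=L_x^{-1}(y)$, regarded as a second basic operation). It is semimedial if $(x*x)*(y*z)=(x*y)*(x*z)$ for all $x,y,z$, and $2$-divisible if $\mathfrak{s}:a\mapsto a*a$ is a bijection. For $2$-divisible semimedial $(Q,* )$, $(Q,\cdot_{\mathfrak{s}})$ is a left quasigroup (in fact a quandle, i.e. idempotent and satisfying $x\cdot(y\cdot z)=(x\cdot y)\cdot(x\cdot z)$). Solvability is in the sense of commutator theory (term operations and congruences with respect to the multiplication and left division): for congruences $\alpha,\beta,\delta$ of an algebra $A$, $C(\alpha,\beta;\delta)$ means that for every $(k+1)$-ary term operation $t$, every $a\,\alpha\,b$ and all $u_1\,\beta\,v_1,\ldots,u_k\,\beta\,v_k$, $t(a,u_1,\ldots,u_k)\,\delta\,t(a,v_1,\ldots,v_k)$ implies $t(b,u_1,\ldots,u_k)\,\delta\,t(b,v_1,\ldots,v_k)$. A congruence $\alpha$ is abelian if $C(\alpha,\alpha;0_A)$, where $0_A$ is equality. $A$ is solvable if there is a chain of congruences $0_A=\alpha_0\leq\ldots\leq\alpha_m=1_A=A\times A$ with $\alpha_{i+1}/\alpha_i$ abelian in $A/\alpha_i$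 for all $i$. *)

(* Defs.v *)
From mathcomp Require Import all_boot.

Set Implicit Arguments.
Unset Strict Implicit.
Unset Printing Implicit Defensive.

Local Open Scope quotient_scope.

Record lquasigroup (T : Type) := LQuasigroup {
  lmul : T -> T -> T;
  ldiv : T -> T -> T;
  lmulK : forall x, cancel (lmul x) (ldiv x);
  ldivK : forall x, cancel (ldiv x) (lmul x)
}.

Definition sq (T : Type) (A : lquasigroup T) (x : T) : T := lmul A x x.

Definition semimedial (T : Type) (A : lquasigroup T) : Prop :=
  forall x y z,
    lmul A (lmul A x x) (lmul A y z) = lmul A (lmul A x y) (lmul A x z).

Definition two_divisible (T : Type) (A : lquasigroup T) : Prop :=
  bijective (sq A).

Section SquareTwist.

Variables (T : finType) (A : lquasigroup T) (hs : two_divisible A).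

Definition inv_sq : T -> T := invF (bij_inj hs).

Definition smul (x y : T) : T := inv_sq (lmul A x y).

Definition sdiv (x y : T) : T := ldiv A x (sq A y).

Fact smulK x : cancel (smul x) (sdiv x).
Proof. by move=> y; rewrite /sdiv /smul /inv_sq f_invF lmulK. Qed.

Fact sdivK x : cancel (sdiv x) (smul x).
Proof. by move=> y; rewrite /sdiv /smul /inv_sq ldivK invF_f. Qed.

Definition sq_twist : lquasigroup T := LQuasigroup smulK sdivK.

End SquareTwist.

Inductive lqterm (n : nat) : Type :=
  | LVar of 'I_n
  | LMul of lqterm n & lqterm n
  | LDiv of lqterm n & lqterm n.

Fixpoint lqeval (T : Type) (A : lquasigroup T) (n : nat) (t : lqterm n)
    (e : n.-tuple T) : T :=
  match t with
  | LVar i => tnth e i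
  | LMul t1 t2 => lmul A (lqeval A t1 e) (lqeval A t2 e)
  | LDiv t1 t2 => ldiv A (lqeval A t1 e) (lqeval A t2 e)
  end.

(* Relations are boolean; on a finite carrier this is no restriction, since
   only relations that are decided by a boolean exist there classically. *)
Record congruence (T : choiceType) (A : lquasigroup T) := Congruence {
  cong_rel :> equiv_rel T;
  cong_lmul : forall x x' y y',
    cong_rel x x' -> cong_rel y y' -> cong_rel (lmul A x y) (lmul A x' y');
  cong_ldiv : forall x x' y y',
    cong_rel x x' -> cong_rel y y' -> cong_rel (ldiv A x y) (ldiv A x' y')
}.

Definition centralizes (T : choiceType) (A : lquasigroup T)
    (alpha beta delta : congruence A) : Prop :=
  forall (k : nat) (t : lqterm k.+1) (a b : T) (u v : k.-tuple T),
    alpha a b ->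
    (forall i : 'I_k, beta (tnth u i) (tnth v i)) ->
    delta (lqeval A t [tuple of a :: u]) (lqeval A t [tuple of a :: v]) ->
    delta (lqeval A t [tuple of b :: u]) (lqeval A t [tuple of b :: v]).

Section ZeroCongruence.

Variables (T : choiceType) (A : lquasigroup T).

Fact eq_op_trans : transitive (@eq_op T).
Proof. by move=> y x z /eqP-> /eqP->. Qed.

Definition eq_op_equiv : equiv_rel T :=
  EquivRel (@eq_op T) (@eqxx T) (@eq_sym T) eq_op_trans.

Fact eq_op_lmul x x' y y' :
  eq_op_equiv x x' -> eq_op_equiv y y' ->
  eq_op_equiv (lmul A x y) (lmul A x' y').
Proof. by move=> /= /eqP-> /eqP->. Qed.

Fact eq_op_ldiv x x' y y' :
  eq_op_equiv x x' -> eq_op_equiv y y' ->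
  eq_op_equiv (ldiv A x y) (ldiv A x' y').
Proof. by move=> /= /eqP-> /eqP->. Qed.

Definition zero_cong : congruence A := Congruence eq_op_lmul eq_op_ldiv.

End ZeroCongruence.

Definition abelian_cong (T : choiceType) (A : lquasigroup T)
    (alpha : congruence A) : Prop :=
  centralizes alpha alpha (zero_cong A).

Section Quotient.

Variables (T : choiceType) (A : lquasigroup T) (alpha : congruence A).

Definition cong_quot : choiceType := {eq_quot alpha}.

Definition cong_pi (x : T) : cong_quot := \pi_({eq_quot alpha}) x.

Definition cong_repr (x : cong_quot) : T := repr (x : {eq_quot alpha}).

Fact cong_reprK : cancel cong_repr cong_pi.
Proof. by move=> x; rewrite /cong_pi /cong_repr reprK. Qed.

Fact cong_piP x y : reflect (cong_pi x = cong_pi y) (alpha x y).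
Proof. exact: eqmodP. Qed.

Fact cong_repr_pi x : alpha (cong_repr (cong_pi x)) x.
Proof. by apply/cong_piP; rewrite cong_reprK. Qed.

Definition quot_mul (x y : cong_quot) : cong_quot :=
  cong_pi (lmul A (cong_repr x) (cong_repr y)).

Definition quot_div (x y : cong_quot) : cong_quot :=
  cong_pi (ldiv A (cong_repr x) (cong_repr y)).

Fact quot_mulE x y : quot_mul (cong_pi x) (cong_pi y) = cong_pi (lmul A x y).
Proof. by apply/cong_piP; apply: cong_lmul; apply: cong_repr_pi. Qed.

Fact quot_divE x y : quot_div (cong_pi x) (cong_pi y) = cong_pi (ldiv A x y).
Proof. by apply/cong_piP; apply: cong_ldiv; apply: cong_repr_pi. Qed.

Fact quot_mulK x : cancel (quot_mul x) (quot_div x).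
Proof.
move=> y; rewrite -(cong_reprK x) -(cong_reprK y).
by rewrite quot_mulE quot_divE lmulK.
Qed.

Fact quot_divK x : cancel (quot_div x) (quot_mul x).
Proof.
move=> y; rewrite -(cong_reprK x) -(cong_reprK y).
by rewrite quot_divE quot_mulE ldivK.
Qed.

Definition quot_lq : lquasigroup cong_quot := LQuasigroup quot_mulK quot_divK.

Variables (beta : congruence A) (le_ab : subrel alpha beta).

(* As alpha <= beta, relating representatives is the same as relating some
   (equivalently, all) members of the two alpha-classes; see quot_relE. *)
Definition quot_rel (x y : cong_quot) : bool :=
  beta (cong_repr x) (cong_repr y).

Fact quot_relE x y : quot_rel (cong_pi x) (cong_pi y) = beta x y.
Proof.
have bx z : beta (cong_repr (cong_pi z)) z by apply/le_ab/cong_repr_pi.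
rewrite /quot_rel; apply/idP/idP => h.
  by apply: equiv_trans (bx y); apply: equiv_trans h; rewrite equiv_sym.
apply: (equiv_trans (bx x)); apply: equiv_trans h _.
by rewrite equiv_sym.
Qed.

Fact quot_rel_refl : reflexive quot_rel.
Proof. by move=> x; apply: equiv_refl. Qed.

Fact quot_rel_sym : symmetric quot_rel.
Proof. by move=> x y; apply: equiv_sym. Qed.

Fact quot_rel_trans : transitive quot_rel.
Proof. by move=> y x z; apply: equiv_trans. Qed.

Definition quot_equiv : equiv_rel cong_quot :=
  EquivRel quot_rel quot_rel_refl quot_rel_sym quot_rel_trans.

Fact quot_cong_mul x x' y y' :
  quot_equiv x x' -> quot_equiv y y' ->
  quot_equiv (lmul quot_lq x y) (lmul quot_lq x' y').
Proof. by move=> /= hx hy; rewrite quot_relE; apply: cong_lmul. Qed.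

Fact quot_cong_div x x' y y' :
  quot_equiv x x' -> quot_equiv y y' ->
  quot_equiv (ldiv quot_lq x y) (ldiv quot_lq x' y').
Proof. by move=> /= hx hy; rewrite quot_relE; apply: cong_ldiv. Qed.

Definition quot_cong : congruence quot_lq :=
  Congruence quot_cong_mul quot_cong_div.

End Quotient.

Definition solvable_lq (T : choiceType) (A : lquasigroup T) : Prop :=
  exists (m : nat) (alpha : nat -> congruence A)
         (le_alpha : forall i, i < m -> subrel (alpha i) (alpha i.+1)),
    [/\ forall x y, alpha 0 x y = (x == y),
        forall x y, alpha m x y
      & forall i (lt_im : i < m), abelian_cong (quot_cong (le_alpha i lt_im))].

(* Main.v *)
(** The operation [x · y] is a term operation of the left quasigroup [*],
    because on a finite set the inverse of the squaring map [s] is a power of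
    [s]; so solvability passes from [*] to [·].  Conversely [s] is an
    automorphism of both operations and [x * y = s (x · y)], so the congruences
    of [*] are the [s]-invariant congruences of [·], and for such congruences
    both operations have the same centralizing relation.  A solvable chain of
    [·] is made [s]-invariant by replacing each congruence by the intersection
    of its preimages under all automorphisms of [·]. *)
Require Import Defs.
From mathcomp Require Import all_boot all_fingroup.

Set Implicit Arguments.
Unset Strict Implicit.
Unset Printing Implicit Defensive.

(** An injective self-map of a finite set is a permutation of finite order, and its inverse is the
    power with exponent that order minus one. *)
Lemma iter_invF (T : finType) (f : T -> T) (fI : injective f) :
  exists n, forall x, invF fI x = iter n f x.
Proof.
exists #[perm fI]%g.-1 => x; apply: (fI).
rewrite f_invF -iterS prednK ?order_gt0 //.
have -> : iter #[perm fI]%g f x = iter #[perm fI]%g (perm fI) x.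
  by apply: eq_iter => y; rewrite permE.
by rewrite -permX expg_order perm1.
Qed.

(** * Commutator matrices *)

(* The matrices [[x, y], [z, w]] = [[t(a,u), t(a,v)], [t(b,u), t(b,v)]] with
   tuples [a alpha b] and [u beta v]: the subalgebra of 2 x 2 matrices
   generated by those with equal columns or equal rows. *)
Inductive cmatrix (T : Type) (A : lquasigroup T) (alpha beta : rel T) :
    T -> T -> T -> T -> Prop :=
  | CMatrixL a b of alpha a b : cmatrix A alpha beta a a b b
  | CMatrixR u v of beta u v : cmatrix A alpha beta u v u v
  | CMatrixMul x y z w x' y' z' w' of
      cmatrix A alpha beta x y z w & cmatrix A alpha beta x' y' z' w' :
      cmatrix A alpha beta
        (lmul A x x') (lmul A y y') (lmul A z z') (lmul A w w')
  | CMatrixDiv x y z w x' y' z' w' of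
      cmatrix A alpha beta x y z w & cmatrix A alpha beta x' y' z' w' :
      cmatrix A alpha beta
        (ldiv A x x') (ldiv A y y') (ldiv A z z') (ldiv A w w').

Lemma cmatrix_morph (T T' : Type) (A : lquasigroup T) (A' : lquasigroup T')
    (f : T -> T') (alpha beta : rel T) (alpha' beta' : rel T') :
  {morph f : x y / lmul A x y >-> lmul A' x y} ->
  {morph f : x y / ldiv A x y >-> ldiv A' x y} ->
  (forall x y, alpha x y -> alpha' (f x) (f y)) ->
  (forall x y, beta x y -> beta' (f x) (f y)) ->
  forall x y z w, cmatrix A alpha beta x y z w ->
  cmatrix A' alpha' beta' (f x) (f y) (f z) (f w).
Proof.
move=> fM fD f_alpha f_beta x y z w.
elim=> {x y z w} [a b /f_alpha|u v /f_beta|x y z w x' y' z' w' _ m _ m'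
                 |x y z w x' y' z' w' _ m _ m'].
- exact: CMatrixL.
- exact: CMatrixR.
- by rewrite !fM; apply: CMatrixMul.
- by rewrite !fD; apply: CMatrixDiv.
Qed.

(** Lets a row of one factor of a product serve as a pair of [beta]-related parameters while the
    other factor varies. *)
Lemma cmatrix_rows (T : choiceType) (A : lquasigroup T) (alpha : rel T)
    (beta : congruence A) x y z w :
  cmatrix A alpha beta x y z w -> beta x y /\ beta z w.
Proof.
elim=> {x y z w} [a b _|u v //|x y z w x' y' z' w' _ [m1 m2] _ [m1' m2']
                 |x y z w x' y' z' w' _ [m1 m2] _ [m1' m2']].
- by rewrite !equiv_refl.
- by split; apply: cong_lmul.
- by split; apply: cong_ldiv.
Qed.

(** * Term substitution and the term condition in matrix form *)

Fixpoint lqsubst (n m : nat) (s : 'I_n -> lqterm m) (t : lqterm n) : lqterm m :=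
  match t with
  | LVar i => s i
  | LMul t1 t2 => LMul (lqsubst s t1) (lqsubst s t2)
  | LDiv t1 t2 => LDiv (lqsubst s t1) (lqsubst s t2)
  end.

Lemma lqeval_subst (T : Type) (A : lquasigroup T) n m (s : 'I_n -> lqterm m) t
    (e : m.-tuple T) :
  lqeval A (lqsubst s t) e = lqeval A t [tuple lqeval A (s i) e | i < n].
Proof. by elim: t => [i|t1 /= -> t2 ->|t1 /= -> t2 ->] //=; rewrite tnth_mktuple. Qed.

(** Absorbs an operation applied at the head into the term, its other operand [p] joining the
    parameters. *)
Lemma lqeval_subst_head (T : Type) (A : lquasigroup T) k (t : lqterm k.+1)
    (s : lqterm k.+2) :
  exists t' : lqterm k.+2, forall (x p : T) (u : k.-tuple T),
    lqeval A t' [tuple of x :: p :: u]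
    = lqeval A t [tuple of lqeval A s [tuple of x :: p :: u] :: u].
Proof.
pose sub (i : 'I_k.+1) : lqterm k.+2 :=
  if unlift ord0 i is Some j then LVar (lift ord0 (lift ord0 j)) else s.
exists (lqsubst sub t) => x p u; rewrite lqeval_subst; congr (lqeval A t _).
apply: eq_from_tnth => i; rewrite tnth_mktuple /sub.
by case: unliftP => [j|] -> //=; rewrite !tnthS.
Qed.

(** A generated matrix may involve several [alpha]-pairs, whereas the term condition changes a
    single one; they are therefore exchanged one at a time. Conversely, induction on the term shows
    that its values form a generated matrix. *)
Lemma centralizesP (T : choiceType) (A : lquasigroup T)
    (alpha beta delta : congruence A) :
  centralizes alpha beta delta <->
  (forall x y z w, cmatrix A alpha beta x y z w -> delta x y -> delta z w).
Proof.
split=> [C x y z w m|C k t a b u v ab uv]; last first.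
  apply: C; elim: t => [i|t1 m1 t2 m2|t1 m1 t2 m2] /=.
  - case: (unliftP ord0 i) => [j|] ->; first by rewrite !tnthS; apply: CMatrixR.
    exact: CMatrixL.
  - exact: CMatrixMul.
  - exact: CMatrixDiv.
(* Generalizing over a surrounding term lets the entries of a product be
   replaced one after the other. *)
suff H k (t : lqterm k.+1) (u v : k.-tuple T) :
    (forall i, beta (tnth u i) (tnth v i)) ->
    delta (lqeval A t [tuple of x :: u]) (lqeval A t [tuple of y :: v]) ->
    delta (lqeval A t [tuple of z :: u]) (lqeval A t [tuple of w :: v]).
  by apply: (H 0 (LVar ord0) [tuple] [tuple]) => - [].
have cons_rel j (u' v' : j.-tuple T) p q : beta p q ->
    (forall i, beta (tnth u' i) (tnth v' i)) ->
    forall i, beta (tnth [tuple of p :: u'] i) (tnth [tuple of q :: v'] i).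
  by move=> pq uv' i; case: (unliftP ord0 i) => [l|] -> //; rewrite !tnthS.
elim: m k t u v => {x y z w} [a b ab|u' v' _|x y z w x' y' z' w' m IH m' IH'
                |x y z w x' y' z' w' m IH m' IH'] k t u v uv.
- exact: C.
- by [].
(* With [t1] the left factors pass from [x], [y] to [z], [w] while [x'], [y'] are parameters; with
   [t2] the right factors then pass to [z'], [w'] while [z], [w] are parameters. *)
- have [_ zw] := cmatrix_rows m; have [xy' _] := cmatrix_rows m'.
  have [t1 t1E] := lqeval_subst_head A t
                     (LMul (LVar ord0) (LVar (lift ord0 ord0))).
  have [t2 t2E] := lqeval_subst_head A t
                     (LMul (LVar (lift ord0 ord0)) (LVar ord0)).
  move=> h; move: (IH _ t1 _ _ (cons_rel _ _ _ _ _ xy' uv)); rewrite !t1E => /(_ h).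
  by move=> h'; move: (IH' _ t2 _ _ (cons_rel _ _ _ _ _ zw uv)); rewrite !t2E; apply.
- have [_ zw] := cmatrix_rows m; have [xy' _] := cmatrix_rows m'.
  have [t1 t1E] := lqeval_subst_head A t
                     (LDiv (LVar ord0) (LVar (lift ord0 ord0))).
  have [t2 t2E] := lqeval_subst_head A t
                     (LDiv (LVar (lift ord0 ord0)) (LVar ord0)).
  move=> h; move: (IH _ t1 _ _ (cons_rel _ _ _ _ _ xy' uv)); rewrite !t1E => /(_ h).
  by move=> h'; move: (IH' _ t2 _ _ (cons_rel _ _ _ _ _ zw uv)); rewrite !t2E; apply.
Qed.

(** Matrices project to the quotient and lift back along representatives, and equality in the
    quotient is [alpha] upstairs. *)
Lemma abelian_quotP (T : choiceType) (A : lquasigroup T)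
    (alpha beta : congruence A) (le_ab : subrel alpha beta) :
  abelian_cong (quot_cong le_ab) <-> centralizes beta beta alpha.
Proof.
rewrite /abelian_cong; split=> /centralizesP C; apply/centralizesP => x y z w m.
  move=> /cong_piP xy; apply/cong_piP/eqP.
  apply: (C (cong_pi alpha x) (cong_pi alpha y)); last exact/eqP.
  apply: cmatrix_morph m => [a b|a b|a b|a b] /=.
  - by rewrite quot_mulE.
  - by rewrite quot_divE.
  - by rewrite quot_relE.
  - by rewrite quot_relE.
suff [x' [y' [z' [w' [m' -> -> -> ->]]]]] :
    exists x', exists y', exists z', exists w',
      [/\ cmatrix A beta beta x' y' z' w', x = cong_pi alpha x',
          y = cong_pi alpha y', z = cong_pi alpha z' & w = cong_pi alpha w'].
  by move=> /eqP/cong_piP xy; apply/eqP/cong_piP; apply: C m' xy.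
elim: m => {x y z w} [a b ab|u v uv
    |_ _ _ _ _ _ _ _ _ [x [y [z [w [m -> -> -> ->]]]]]
                     _ [x' [y' [z' [w' [m' -> -> -> ->]]]]]
    |_ _ _ _ _ _ _ _ _ [x [y [z [w [m -> -> -> ->]]]]]
                     _ [x' [y' [z' [w' [m' -> -> -> ->]]]]]].
- exists (cong_repr a), (cong_repr a), (cong_repr b), (cong_repr b).
  by split; rewrite ?cong_reprK //; apply: CMatrixL.
- exists (cong_repr u), (cong_repr v), (cong_repr u), (cong_repr v).
  by split; rewrite ?cong_reprK //; apply: CMatrixR.
- exists (lmul A x x'), (lmul A y y'), (lmul A z z'), (lmul A w w').
  by split; rewrite /= ?quot_mulE //; apply: CMatrixMul.
- exists (ldiv A x x'), (ldiv A y y'), (ldiv A z z'), (ldiv A w w').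
  by split; rewrite /= ?quot_divE //; apply: CMatrixDiv.
Qed.

(** Removes quotients, so that chains for two operations on the same carrier can be compared
    directly. *)
Lemma solvable_lqP (T : choiceType) (A : lquasigroup T) :
  solvable_lq A <->
  exists (m : nat) (alpha : nat -> congruence A),
    [/\ forall x y, alpha 0 x y = (x == y), forall x y, alpha m x y,
        forall i, i < m -> subrel (alpha i) (alpha i.+1)
      & forall i, i < m -> forall x y z w,
          cmatrix A (alpha i.+1) (alpha i.+1) x y z w ->
          alpha i x y -> alpha i z w].
Proof.
split=> [[m [alpha [le_alpha [a0 am ab]]]]|[m [alpha [a0 am le_alpha ab]]]].
  exists m, alpha; split=> // i im.
  exact/centralizesP/(abelian_quotP (le_alpha i im))/ab.
exists m, alpha, le_alpha; split=> // i im.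
exact/abelian_quotP/centralizesP/ab.
Qed.

(** * Automorphism-invariant congruences *)

Section CharacteristicCore.

Variables (T : finType) (A : lquasigroup T).

(** A finite set, so that an intersection indexed by automorphisms is again a boolean relation. *)
Definition lq_aut : {set {perm T}} :=
  [set p : {perm T} | [forall x, forall y, p (lmul A x y) == lmul A (p x) (p y)]].

Lemma lq_autP (p : {perm T}) :
  reflect {morph p : x y / lmul A x y} (p \in lq_aut).
Proof.
rewrite inE; apply: (iffP forallP) => [h x y|h x]; first exact/eqP/(forallP (h x)).
by apply/forallP => y; rewrite h.
Qed.

Lemma lq_aut_div (p : {perm T}) :
  p \in lq_aut -> {morph p : x y / ldiv A x y}.
Proof.
by move=> /lq_autP pM x y; apply: (can_inj (lmulK A (p x))); rewrite -pM !ldivK.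
Qed.

Lemma lq_aut1 : 1%g \in lq_aut.
Proof. by apply/lq_autP => x y; rewrite !perm1. Qed.

Lemma lq_autM (p q : {perm T}) :
  p \in lq_aut -> q \in lq_aut -> (p * q)%g \in lq_aut.
Proof. by move=> /lq_autP pM /lq_autP qM; apply/lq_autP => x y; rewrite !permM pM qM. Qed.

Lemma lq_autV (p : {perm T}) : p \in lq_aut -> (p^-1)%g \in lq_aut.
Proof.
move=> /lq_autP pM; apply/lq_autP => x y.
by apply: (@perm_inj _ p); rewrite pM !permKV.
Qed.

Variable alpha : congruence A.

Definition core_rel (x y : T) : bool := [forall p in lq_aut, alpha (p x) (p y)].

Lemma core_relP x y :
  reflect (forall p, p \in lq_aut -> alpha (p x) (p y)) (core_rel x y).
Proof. exact: forall_inP. Qed.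

Fact core_refl : reflexive core_rel.
Proof. by move=> x; apply/core_relP => p _; apply: equiv_refl. Qed.

Fact core_sym : symmetric core_rel.
Proof. by move=> x y; apply: eq_forallb => p; rewrite equiv_sym. Qed.

Fact core_trans : transitive core_rel.
Proof.
move=> y x z /core_relP xy /core_relP yz; apply/core_relP => p pA.
exact: equiv_trans (xy p pA) (yz p pA).
Qed.

Definition core_equiv : equiv_rel T :=
  EquivRel core_rel core_refl core_sym core_trans.

Fact core_lmul x x' y y' :
  core_equiv x x' -> core_equiv y y' -> core_equiv (lmul A x y) (lmul A x' y').
Proof.
move=> /core_relP hx /core_relP hy; apply/core_relP => p pA.
by rewrite !(lq_autP _ pA); apply: cong_lmul; [apply: hx|apply: hy].
Qed.

Fact core_ldiv x x' y y' :
  core_equiv x x' -> core_equiv y y' -> core_equiv (ldiv A x y) (ldiv A x' y').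
Proof.
move=> /core_relP hx /core_relP hy; apply/core_relP => p pA.
by rewrite !(lq_aut_div pA); apply: cong_ldiv; [apply: hx|apply: hy].
Qed.

(** The largest automorphism-invariant congruence below [alpha]. *)
Definition core_cong : congruence A := Congruence core_lmul core_ldiv.

Lemma core_cong_sub : subrel core_cong alpha.
Proof. by move=> x y /core_relP/(_ _ lq_aut1); rewrite !perm1. Qed.

Lemma core_cong_aut (p : {perm T}) x y :
  p \in lq_aut -> core_cong x y -> core_cong (p x) (p y).
Proof.
move=> pA /core_relP xy; apply/core_relP => q qA.
by rewrite -!permM; apply/xy/lq_autM.
Qed.

End CharacteristicCore.

(** Each automorphism sends a matrix over the core to a matrix over [alpha], where the hypothesis
    applies. *)
Lemma cmatrix_core (T : finType) (A : lquasigroup T)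
    (alpha delta : congruence A) :
  (forall x y z w, cmatrix A alpha alpha x y z w -> delta x y -> delta z w) ->
  forall x y z w, cmatrix A (core_cong alpha) (core_cong alpha) x y z w ->
  core_cong delta x y -> core_cong delta z w.
Proof.
move=> C x y z w m /core_relP xy; apply/core_relP => p pA.
apply: C (xy p pA); apply: cmatrix_morph m.
- exact/lq_autP.
- exact: lq_aut_div.
- by move=> a b /core_relP; apply.
- by move=> a b /core_relP; apply.
Qed.

(** * The square twist *)

Section Twist.

Variables (Q : finType) (A : lquasigroup Q).
Hypotheses (A_semimedial : semimedial A) (hs : two_divisible A).

Let B := sq_twist hs.
Let s := inv_sq hs.
Let sq_perm : {perm Q} := perm (bij_inj hs).

Lemma inv_sqK : cancel s (sq A).
Proof. by move=> x; apply: f_invF. Qed.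

Lemma lmul_twist x y : lmul A x y = sq_perm (lmul B x y).
Proof. by rewrite permE /= /smul -/s inv_sqK. Qed.

Lemma ldiv_twist x y : ldiv A x y = ldiv B x ((sq_perm^-1)%g y).
Proof. by rewrite /= /sdiv -[sq A _](permE (bij_inj hs)) permKV. Qed.

(** Semimediality with [z = y] reads [(x*x)*(y*y) = (x*y)*(x*y)]: squaring is an endomorphism of
    [A], hence of [B] after cancelling one square. *)
Lemma sq_perm_aut : sq_perm \in lq_aut B.
Proof.
apply/lq_autP => x y; apply: (@perm_inj _ sq_perm).
by rewrite -!lmul_twist !permE /sq -A_semimedial.
Qed.

Lemma inv_sq_iter : exists n, forall x, s x = iter n (sq A) x.
Proof. exact: iter_invF. Qed.

Lemma cong_inv_sq (alpha : congruence A) x y : alpha x y -> alpha (s x) (s y).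
Proof.
have [n nE] := inv_sq_iter; rewrite !nE => xy.
by elim: n {nE} => //= n IH; apply: cong_lmul.
Qed.

Lemma cmatrix_inv_sq (alpha beta : rel Q) x y z w :
  cmatrix A alpha beta x y z w -> cmatrix A alpha beta (s x) (s y) (s z) (s w).
Proof.
have [n nE] := inv_sq_iter; rewrite !nE => m.
by elim: n {nE} => //= n IH; apply: CMatrixMul.
Qed.

Lemma cmatrix_of_twist (alpha beta : rel Q) x y z w :
  cmatrix B alpha beta x y z w -> cmatrix A alpha beta x y z w.
Proof.
elim=> {x y z w} [a b|u v|x y z w x' y' z' w' _ m _ m'
                 |x y z w x' y' z' w' _ m _ m'].
- exact: CMatrixL.
- exact: CMatrixR.
- exact/cmatrix_inv_sq/CMatrixMul.
(* Division in [B] is division in [A] by [x] of the square of [y]. *)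
- by apply: CMatrixDiv => //; apply: CMatrixMul.
Qed.

(** Squaring need not be a term operation of the idempotent [B], but it is an automorphism, so it
    preserves matrices over an invariant relation. *)
Lemma cmatrix_to_twist (alpha : rel Q) x y z w :
  (forall p a b, p \in lq_aut B -> alpha a b -> alpha (p a) (p b)) ->
  cmatrix A alpha alpha x y z w -> cmatrix B alpha alpha x y z w.
Proof.
move=> alpha_aut.
have autB p a b c d : p \in lq_aut B ->
    cmatrix B alpha alpha a b c d ->
    cmatrix B alpha alpha (p a) (p b) (p c) (p d).
  move=> pB; apply: cmatrix_morph => [| |a' b'|a' b'].
  - exact/lq_autP.
  - exact: lq_aut_div.
  - exact: alpha_aut.
  - exact: alpha_aut.
elim=> {x y z w} [a b|u v|x y z w x' y' z' w' _ m _ m'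
                 |x y z w x' y' z' w' _ m _ m'].
- exact: CMatrixL.
- exact: CMatrixR.
- by rewrite !lmul_twist; apply: autB; [apply: sq_perm_aut|apply: CMatrixMul].
- rewrite !ldiv_twist; apply: CMatrixDiv => //; apply: autB => //.
  exact/lq_autV/sq_perm_aut.
Qed.

(** * Transfer of congruences between the two operations *)

Fact twist_cong_lmul (alpha : congruence A) x x' y y' :
  alpha x x' -> alpha y y' -> alpha (lmul B x y) (lmul B x' y').
Proof. by move=> hx hy; apply/cong_inv_sq/cong_lmul. Qed.

Fact twist_cong_ldiv (alpha : congruence A) x x' y y' :
  alpha x x' -> alpha y y' -> alpha (ldiv B x y) (ldiv B x' y').
Proof. by move=> hx hy; apply: cong_ldiv => //; apply: cong_lmul. Qed.

Definition twist_cong (alpha : congruence A) : congruence B :=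
  Congruence (@twist_cong_lmul alpha) (@twist_cong_ldiv alpha).

Fact untwist_cong_lmul (alpha : congruence B) x x' y y' :
  core_cong alpha x x' -> core_cong alpha y y' ->
  core_cong alpha (lmul A x y) (lmul A x' y').
Proof.
move=> hx hy; rewrite !lmul_twist.
by apply: core_cong_aut; [apply: sq_perm_aut|apply: cong_lmul].
Qed.

Fact untwist_cong_ldiv (alpha : congruence B) x x' y y' :
  core_cong alpha x x' -> core_cong alpha y y' ->
  core_cong alpha (ldiv A x y) (ldiv A x' y').
Proof.
move=> hx hy; rewrite !ldiv_twist; apply: cong_ldiv => //.
by apply: core_cong_aut => //; apply/lq_autV/sq_perm_aut.
Qed.

(** Built on the core because compatibility with [A] requires invariance under squaring and its
    inverse. *)
Definition untwist_cong (alpha : congruence B) : congruence A :=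
  Congruence (@untwist_cong_lmul alpha) (@untwist_cong_ldiv alpha).

End Twist.

Theorem proposition3p19 (Q : finType) (A : lquasigroup Q)
    (Q_nonempty : 0 < #|Q|) (A_semimedial : semimedial A)
    (A_two_divisible : two_divisible A) :
  solvable_lq A <-> solvable_lq (sq_twist A_two_divisible).
Proof.
split=> /solvable_lqP [m [alpha [a0 am le_alpha ab]]]; apply/solvable_lqP.
  (* The relations stay the same, and every matrix of the twist is already a matrix of [A]. *)
  exists m, (fun i => twist_cong A_two_divisible (alpha i)); split=> // i im x y z w.
  by move/cmatrix_of_twist; apply: ab.
exists m, (fun i => untwist_cong A_semimedial (alpha i)); split=> [x y|x y|i im x y|].
- apply/idP/eqP => [/core_cong_sub|->]; last exact: equiv_refl.
  by rewrite a0 => /eqP.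
- by apply/core_relP.
- move=> /core_relP xy; apply/core_relP => p pB.
  exact/(le_alpha _ im)/xy.
(* Cores are invariant, so a matrix of [A] over them is one of the twist, where the given chain has
   abelian factors. *)
move=> i im x y z w mA; apply: (cmatrix_core (ab i im)).
by apply: cmatrix_to_twist mA => // p a b; apply: core_cong_aut.
Qed.
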